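(* Assume $\mathrm{add}(\mathcal M)=\mathfrak c$ (e.g. assume CH). Then there exist two $\mathrm{add}(\mathcal M)$-Luzin sets $L_0,L_1\subseteq[\mathbb N]^\infty$, each satisfying $\mathsf S_1(B_\Omega,B_\Omega)$ (and therefore each satisfying $\mathrm{Split}(B_\Omega,B_\Omega)$ and $\mathrm{Split}(B_\Lambda,B_\Lambda)$), such that $L_0\cup L_1$ satisfies $\mathrm{Split}(B_\Lambda,B_\Lambda)$ but does not satisfy $\mathrm{Split}(C_\Omega,C_\Omega)$.
   Context: $[\mathbb N]^\infty$ is the set of infinite subsets of $\mathbb N$, a subspace of $P(\mathbb N)\cong\{0,1\}^{\mathbb N}$. $\mathcal M$ is the ideal of meager sets; $\mathrm{add}(\mathcal M)$ is the least cardinality of a family of meager sets whose union is not meager; $\mathfrak c=2^{\aleph_0}$. For an uncountable cardinal $\kappa$, a $\kappa$-Luzin set is a set $L$ with $|L|\ge\kappa$ such that $|L\cap M|<\kappa$ for every meager $M$. A cover of a space $X$ is a family $\mathcal U$ of subsets of $X$ with $\bigcup\mathcal U=X$ such that $X\not\subseteq U$ for all $U\in\mathcal U$; it is a large cover if every $x\in X$ lies in infinitely many members, an $\omega$-cover if every finite subset of $X$ is contained in some member. $B_\Lambda,B_\Omega$ are the collections of countable Borel large covers and countable Borel $\omega$-covers of $X$; $C_\Omega$ the collection of countable clopen $\omega$-covers. $X$ satisfies $\mathrm{Split}(\mathfrak U,\mathfrak V)$ if every $\mathcal U\in\mathfrak U$ can be partitioned into two disjoint subfamilies each containing a subfamily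 belonging to $\mathfrak V$. $X$ satisfies $\mathsf S_1(\mathfrak U,\mathfrak V)$ if for every sequence $(\mathcal U_n)_{n\in\mathbb N}$ of members of $\mathfrak U$ there are $U_n\in\mathcal U_n$ ($n\in\mathbb N$) such that $\{U_n:n\in\mathbb N\}\in\mathfrak V$. *)

(* Defs.v *)
From HB Require Import structures.
From mathcomp Require Import all_boot all_order all_algebra.
From mathcomp Require Import all_classical all_reals all_analysis.
Set Implicit Arguments. Unset Strict Implicit. Unset Printing Implicit Defensive.
Import Order.TTheory GRing.Theory Num.Theory.
Local Open Scope classical_set_scope.

(* P(N) = {0,1}^N with the product topology *)
Notation PN := cantor_space.

Definition infinite_subsets : set PN := [set x | ~ finite_set [set n | x n]].

Definition nowhere_dense (A : set PN) : Prop := interior (closure A) = set0.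

Definition meager (M : set PN) : Prop :=
  exists F : nat -> set PN, (forall n, nowhere_dense (F n)) /\ M `<=` \bigcup_n F n.

(* add(M) = c : every family of fewer than c meager sets has meager union
   (add(M) <= c always holds). |F| < c is expressed as ~ (c <= |F|). *)
Definition addM_eq_c : Prop :=
  forall F : set (set PN), (forall M, F M -> meager M) ->
    ~ ([set: PN] #<= F)%card -> meager (\bigcup_(M in F) M).

(* c-Luzin set (= add(M)-Luzin set under add(M) = c) *)
Definition c_Luzin (L : set PN) : Prop :=
  ([set: PN] #<= L)%card /\
  forall M, meager M -> ~ ([set: PN] #<= (L `&` M))%card.

Definition borel (B : set PN) : Prop := <<s open >> B.
Definition borel_in (X B : set PN) : Prop := exists B', borel B' /\ B = X `&` B'.
Definition clopen_in (X C : set PN) : Prop :=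
  exists O1 O2 : set PN, [/\ open O1, open O2, C = X `&` O1 & X `\` C = X `&` O2].

Definition is_cover (X : set PN) (U : set (set PN)) : Prop :=
  \bigcup_(V in U) V = X /\ forall V, U V -> ~ (X `<=` V).
Definition large_cover (X : set PN) (U : set (set PN)) : Prop :=
  is_cover X U /\ forall x, X x -> ~ finite_set [set V | U V /\ V x].
Definition omega_cover (X : set PN) (U : set (set PN)) : Prop :=
  is_cover X U /\
  forall F : set PN, finite_set F -> F `<=` X -> exists V, U V /\ F `<=` V.

Definition B_Lambda (X : set PN) (U : set (set PN)) : Prop :=
  countable U /\ (forall V, U V -> borel_in X V) /\ large_cover X U.
Definition B_Omega (X : set PN) (U : set (set PN)) : Prop :=
  countable U /\ (forall V, U V -> borel_in X V) /\ omega_cover X U.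
Definition C_Omega (X : set PN) (U : set (set PN)) : Prop :=
  countable U /\ (forall V, U V -> clopen_in X V) /\ omega_cover X U.

Definition Split_sel (A B : set PN -> set (set PN) -> Prop) (X : set PN) : Prop :=
  forall U, A X U -> exists U1 U2 : set (set PN),
    [/\ U1 `|` U2 = U, U1 `&` U2 = set0,
        (exists V1, V1 `<=` U1 /\ B X V1) &
        (exists V2, V2 `<=` U2 /\ B X V2)].

Definition S_one (A B : set PN -> set (set PN) -> Prop) (X : set PN) : Prop :=
  forall Us : nat -> set (set PN), (forall n, A X (Us n)) ->
    exists f : nat -> set PN, (forall n, Us n (f n)) /\ B X (range f).

(* Main.v *)
(** Work along a well-order of type c, all of whose proper initial segments have fewer than c
   elements; by add(M) = c, fewer than c meager conditions can be avoided at each stage. Let U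
   be a countable Borel family, and replace each member by an open set equal to it up to a
   meager set. If U is an omega-cover of a set L that is nonmeager in every open set, then for
   every finite F in L and every m some member of U contains F and is comeager in an open set
   meeting all cylinders of length m. This property of a sequence of covers can be checked on
   the points chosen so far, passes to one generic selection from the sequence, and survives the
   addition of further generic points; hence S_1(B_Omega, B_Omega) for both sets. Stage alpha
   adds two generic points, a to L0 and b to L1, whose intersection is contained in y_alpha or
   in its complement, keeping all finite intersections infinite. So the union of L0 and L1
   generates a nonprincipal ultrafilter, and the omega-cover by the sets {x | n in x} cannot be
   split. For a large cover of a Luzin set cut the indices into consecutive finite blocks long
   enough that a generic point lies, for infinitely many k, in members from both of the blocks
   2k and 2k+1. Taking one block out of each pair splits the cover at all points off a meager
   set, whatever the choices; the remaining, fewer than c, points are handled by choosing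
   generically. *)
Require Import Defs.
From mathcomp Require Import all_boot mathcomp_extra boolp classical_sets functions cardinality.
From mathcomp Require Import topology measure wochoice.
Local Open Scope classical_set_scope.
Set Implicit Arguments.
Unset Strict Implicit.
Unset Printing Implicit Defensive.

(** * Cylinders and meager sets *)

Definition cyl (x : PN) (n : nat) : set PN :=
  [set y | forall i, (i < n)%N -> y i = x i].

Lemma cyl_refl x n : cyl x n x. Proof. by []. Qed.

Lemma cyl_trans x n y m z : (n <= m)%N -> cyl x n y -> cyl y m z -> cyl x n z.
Proof. by move=> nm xy yz i ni; rewrite yz ?xy// (leq_trans ni). Qed.

Lemma nbhs_cyl x n : nbhs x (cyl x n).
Proof.
elim: n => [|n IHn]; first by apply: filterS filterT.
have nx : nbhs x (proj n @^-1` [set x n] : set PN).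
  exact: (@proj_continuous _ (fun=> bool) n x _ (discrete_set1 (x n))).
apply: filterS (filterI IHn nx) => y [yn /= ynx] i.
by rewrite ltnS leq_eqVlt => /predU1P[->|/yn].
Qed.

Lemma open_cyl x n : open (cyl x n).
Proof.
rewrite openE => y xy; apply: filterS (nbhs_cyl y n) => z.
exact: cyl_trans xy.
Qed.

(** The sets containing a cylinder at [x] form a filter, so it is enough to treat the subbasic sets
    of the product topology, each restricting one coordinate. *)
Lemma nbhs_sub_cyl x (O : set PN) : nbhs x O -> exists n, cyl x n `<=` O.
Proof.
pose F : set_system PN := [set A | exists n, cyl x n `<=` A].
have FF : Filter F.
  split; first by exists 0.
    move=> A B [n nA] [m mB]; exists (maxn n m) => y xy; split.
      by apply: nA; apply: cyl_trans xy; rewrite ?leq_maxl.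
    by apply: mB; apply: cyl_trans xy; rewrite ?leq_maxr.
  by move=> A B AB [n nA]; exists n; exact: subset_trans AB.
suff sub : forall V : set PN,
    finI_from [set A | exists i (B : set bool), A = proj i @^-1` B] id V -> V x -> F V.
  case=> P [] [] Q QfinP <- [] V QV Vx QO.
  have [n nV] : F V.
    apply: sub Vx; have [L Lsub VE] := QfinP _ QV; exists L => // A /Lsub.
    by move=> /set_mem [i _ [B _ <-]]; apply/mem_set; exists i, B.
  by exists n; apply: subset_trans nV _; apply: subset_trans QO; exact: bigcup_sup.
move=> V [L Lsub <-] Lx.
apply: filter_bigI => /= M ML.
have Mx : M x by exact: Lx.
have /set_mem [i [A AM]] := Lsub _ ML.
exists i.+1 => y /(_ i (ltnSn i)) xy.
by move: Mx; rewrite AM /preimage /proj /= xy.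
Qed.

Lemma open_sub_cyl x (O : set PN) : open O -> O x -> exists n, cyl x n `<=` O.
Proof. by move=> oO Ox; apply: nbhs_sub_cyl; exact: open_nbhs_nbhs. Qed.

Lemma nowhere_denseP A : nowhere_dense A <->
  forall x n, exists y m, [/\ (n <= m)%N, cyl x n y & cyl y m `<=` ~` A].
Proof.
split=> [A0 x n|nA].
  have [y [xy nAy]] : exists y, cyl x n y /\ ~ closure A y.
    apply: contrapT => nxy.
    suff : interior (closure A) x by rewrite A0.
    apply: filterS (nbhs_cyl x n) => y xy; apply: contrapT => nAy.
    by apply: nxy; exists y.
  have [m ym] : exists m, cyl y m `<=` ~` closure A.
    by apply: open_sub_cyl => //; rewrite openC; exact: closed_closure.
  exists y, (maxn n m); split=> //; first exact: leq_maxl.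
  move=> z yz; apply: (contra_not (@subset_closure _ A z)); apply: ym.
  by apply: cyl_trans yz; rewrite ?leq_maxr.
rewrite /nowhere_dense -subset0 => x /nbhs_sub_cyl [n xn].
have [y [m [_ xy ym]]] := nA x n.
by have [z [Az /ym]] := xn _ xy _ (nbhs_cyl y m).
Qed.

Lemma sub_meager A B : A `<=` B -> meager B -> meager A.
Proof. by move=> AB [F [nF BF]]; exists F; split=> //; exact: subset_trans BF. Qed.

Lemma nowhere_dense_meager A : nowhere_dense A -> meager A.
Proof. by move=> nA; exists (fun=> A); split=> // x Ax; exists 0. Qed.

Lemma nowhere_dense0 : nowhere_dense set0.
Proof. by apply/nowhere_denseP => x n; exists x, n; split=> // z _ []. Qed.

Lemma meager0 : meager set0.
Proof. exact: nowhere_dense_meager nowhere_dense0. Qed.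

Lemma meager_bigcupT (F : nat -> set PN) :
  (forall n, meager (F n)) -> meager (\bigcup_n F n).
Proof.
move=> /choice [G mG].
exists (fun k => if unpickle k is Some (i, j) then G i j else set0); split.
  move=> k; case: unpickle => [[i j]|]; last exact: nowhere_dense0.
  exact: (mG i).1.
move=> x [i _ /((mG i).2) [j _ Gx]]; exists (pickle (i, j)) => //.
by rewrite pickleK.
Qed.

Lemma meager_bigcup_count (I : countType) (F : I -> set PN) :
  (forall i, meager (F i)) -> meager (\bigcup_i F i).
Proof.
move=> mF.
apply: (@sub_meager _ (\bigcup_k if unpickle k is Some i then F i else set0)).
  by move=> x [i _ Fx]; exists (pickle i) => //; rewrite pickleK.
by apply: meager_bigcupT => k; case: unpickle => [i|]; [exact: mF|exact: meager0].
Qed.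

Lemma meagerU A B : meager A -> meager B -> meager (A `|` B).
Proof.
move=> mA mB; apply: (@sub_meager _ (\bigcup_(b : bool) if b then A else B)).
  by move=> x [Ax|Bx]; [exists true|exists false].
by apply: meager_bigcup_count => -[].
Qed.

(** Baire's theorem: the [p k] are nested cylinders, [p k.+1] missing [F k]. Their lengths strictly
    increase, so coordinate [i] of the limit can be read off at stage [i.+1]. *)
Lemma baire M x n : meager M -> exists2 y, cyl x n y & ~ M y.
Proof.
move=> [F [nF MF]].
have /choice [step stepP] : forall k : nat * (PN * nat), exists q : PN * nat,
    [/\ (k.2.2 < q.2)%N, cyl k.2.1 k.2.2 q.1 & cyl q.1 q.2 `<=` ~` F k.1].
  move=> [k [z m]] /=.
  have /nowhere_denseP/(_ z m.+1)[y [l [ml zy ym]]] := nF k.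
  by exists (y, l); split=> //; apply: (@cyl_trans _ _ y m.+1) => // i im; rewrite zy// ltnS ltnW.
pose p := fix p k := if k is l.+1 then step (l, p l) else (x, n).
have psub i j z : (i <= j)%N -> cyl (p j).1 (p j).2 z -> cyl (p i).1 (p i).2 z.
  move=> /subnKC <-; elim: (j - i) z => [|d IHd] z; first by rewrite addn0.
  rewrite addnS => pz; apply: IHd.
  have [lt_p pp _] := stepP (i + d, p (i + d)).
  by apply: cyl_trans pp pz; rewrite ltnW.
have pgt i : (i <= (p i).2)%N.
  elim: i => // i IHi; have [lt_p _ _] := stepP (i, p i).
  exact: leq_ltn_trans lt_p.
pose y : PN := fun i => (p i.+1).1 i.
have py k : cyl (p k).1 (p k).2 y.
  move=> i ik; rewrite /y; have [ki|ik'] := leqP k i.+1.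
    by apply: (psub k i.+1 _ ki (@cyl_refl _ _) i ik).
  by symmetry; apply: (psub i.+1 k (p k).1 (ltnW ik') (@cyl_refl _ _) i); exact: pgt.
exists y; first exact: (py 0).
move=> /MF [k _]; have [_ _] := stepP (k, p k); apply; exact: (py k.+1).
Qed.

(** * Coordinate changes under which preimages of meager sets are meager *)

Section coordinates.
Variables (t : nat -> bool) (e : nat -> nat).
Hypotheses (e_inj : injective e) (e_ge : forall k, (k <= e k)%N).

Definition twist (c : PN) : PN := fun k => t k (+) c (e k).

(** From coordinate [n] on, [c] solves [t k (+) c (e k) = y k], consistently because [e] is
    injective. If [e k < n], then [k < n] by [e_ge], and there [y] already agrees with [twist x]. *)
Lemma twist_lift x n y m : (n <= m)%N -> cyl (twist x) n y ->
  exists c l, [/\ (n <= l)%N, cyl x n c & forall d, cyl c l d -> cyl y m (twist d)].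
Proof.
move=> nm xy.
pose c : PN := fun j => if (j < n)%N then x j else
  if [pick k : 'I_m | e k == j] is Some k then t k (+) y k else x j.
exists c, (maxn n (\max_(k < m) (e k).+1)); split; first exact: leq_maxl.
  by move=> i ni; rewrite /c ni.
move=> d cd k km; rewrite /twist cd; last first.
  rewrite leq_max; apply/orP; right.
  exact: (@leq_bigmax _ (fun k : 'I_m => (e k).+1) (Ordinal km)).
rewrite /c; case: ltnP => [ekn|_].
  by rewrite xy//; exact: leq_ltn_trans ekn.
case: pickP => [k' /eqP /e_inj ->|/(_ (Ordinal km))]; last by rewrite /= eqxx.
by rewrite addbA addbb.
Qed.

Lemma meager_twist M : meager M -> meager (twist @^-1` M).
Proof.
move=> [F [nF MF]]; exists (fun n => twist @^-1` F n); split; last first.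
  by move=> c /MF [n _ Fn]; exists n.
move=> k; apply/nowhere_denseP => x n.
have /nowhere_denseP/(_ (twist x) n)[y [m [nm xy ym]]] := nF k.
have [c [l [nl xc cl]]] := twist_lift nm xy.
by exists c, l; split=> // d /cl /ym.
Qed.

End coordinates.

(** * Small index sets and encodings by points of the Cantor space *)

(** Under [addM_eq_c] this holds for every set of size less than the continuum; closure rules for it
    replace cardinal arithmetic. *)
Definition small T (I : set T) : Prop := forall Q : T -> set PN,
  (forall t, I t -> meager (Q t)) -> meager (\bigcup_(t in I) Q t).

Lemma small_addM T (I : set T) :
  addM_eq_c -> ~ ([set: PN] #<= I)%card -> small I.
Proof.
move=> add cI Q mQ.
have -> : \bigcup_(t in I) Q t = \bigcup_(M in Q @` I) M by rewrite bigcup_image.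
apply: add.
  by move=> _ [t It <-]; exact: mQ.
by apply: contra_not cI => /card_le_trans; apply; exact: card_image_le.
Qed.

Lemma sub_small T (I J : set T) : I `<=` J -> small J -> small I.
Proof.
move=> IJ sJ Q mQ.
apply: (@sub_meager _ (\bigcup_(t in J) if pselect (I t) is left _ then Q t else set0)).
  by move=> x [t It Qx]; exists t; [exact: IJ|case: pselect].
by apply: sJ => t _; case: pselect => [/mQ//|_]; exact: meager0.
Qed.

Lemma small_image T U (f : T -> U) (I : set T) : small I -> small (f @` I).
Proof.
by move=> sI Q mQ; rewrite bigcup_image; apply: sI => t It; apply: mQ; exists t.
Qed.

Lemma smallU T (I J : set T) : small I -> small J -> small (I `|` J).
Proof.
move=> sI sJ Q mQ; rewrite bigcup_setU; apply: meagerU.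
  by apply: sI => t It; apply: mQ; left.
by apply: sJ => t It; apply: mQ; right.
Qed.

Lemma small1 T (x : T) : small [set x].
Proof. by move=> Q mQ; rewrite bigcup_set1; exact: mQ. Qed.

(* Uniting over one coordinate at a time replaces cardinal arithmetic on finite sequences. *)
Lemma small_seq (T : eqType) (I : set T) :
  small I -> small [set s : seq T | forall x, x \in s -> I x].
Proof.
move=> sI Q mQ.
pose In n := [set s : seq T | size s = n /\ (forall x, x \in s -> I x)].
have sIn n : small (In n).
  elim: n => [|n IHn] {mQ}{}Q mQ.
    apply: (@sub_meager _ (Q [::])); last exact: mQ.
    by move=> x [s [/size0nil -> _] Qx].
  apply: (@sub_meager _ (\bigcup_(t in I) \bigcup_(s in In n) Q (t :: s))).
    move=> x [[|t s] [//= [sn] sI'] Qx]; exists t; first by apply: sI'; rewrite mem_head.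
    by exists s => //; split=> // y ys; apply: sI'; rewrite in_cons ys orbT.
  apply: sI => t It; apply: IHn => s [sn sI']; apply: mQ; split; first by rewrite /= sn.
  by move=> y; rewrite in_cons => /predU1P[->|/sI'].
apply: (@sub_meager _ (\bigcup_n \bigcup_(s in In n) Q s)).
  by move=> x [s sI' Qx]; exists (size s) => //; exists s.
by apply: meager_bigcupT => n; apply: sIn => s [_ sI']; exact: mQ.
Qed.

(** From a well-order of [PN] keep the shortest initial segment of size continuum, or all of [PN] if
    no proper segment is that large; [tau] enumerates [PN] along it. *)
Lemma continuum_well_order : exists (S : eqType) (lt : S -> S -> Prop) (tau : S -> PN),
  [/\ well_founded lt,
      forall a b, [\/ lt a b, a = b | lt b a],
      forall a b c, lt a b -> lt b c -> lt a c,
      forall a, ~ ([set: PN] #<= [set b | lt b a])%card &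
      forall y, exists a, tau a = y].
Proof.
have [R woR] := well_ordering_principle PN.
have minR (P : set PN) : P !=set0 -> exists z, P z /\ forall x, P x -> R z x.
  move=> [x Px]; have [|z [[zP Pz] _]] := woR [pred x | `[< P x >]].
    by exists x; apply/asboolP.
  by exists z; split; [exact/asboolP|move=> y Py; apply: Pz; exact/asboolP].
have wcR : wo_chain R predT by exact: withinW.
have totR x y : R x y || R y x by exact: (wo_chainW wcR).
have antiR x y : R x y -> R y x -> x = y.
  by move=> xy yx; apply: (wo_chain_antisymmetric wcR); rewrite ?xy.
have trR y x z : R x y -> R y z -> R x z.
  move=> xy yz; have [|m [[[mx|my]|mz] mR]] := minR [set x; y; z].
  - by exists x; left; left.
  - by rewrite -mx; apply: mR; right.
  - rewrite (antiR x y) // -my; apply: mR; by left; left.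
  - rewrite -(antiR y z) // -mz; apply: mR; by left; right.
pose lt0 x y := R x y /\ x <> y.
have lt0R x y z : lt0 x y -> R y z -> lt0 x z.
  move=> [xy nxy] yz; split; first exact: trR yz.
  by move=> xz; apply: nxy; apply: antiR => //; rewrite xz.
have min0 (P : set PN) : P !=set0 -> exists z, P z /\ forall x, lt0 x z -> ~ P x.
  move=> /minR[z [Pz zR]]; exists z; split=> // x [xz nxz] Px.
  by apply: nxz; apply: antiR => //; exact: zR.
have [D [cD segD]] : exists D : set PN, ([set: PN] #<= D)%card /\
    forall a, D a -> ~ ([set: PN] #<= [set b | lt0 b a])%card.
  have [nz|nz] := pselect ([set z | ([set: PN] #<= [set b | lt0 b z])%card] !=set0).
    have [z [cz zmin]] := min0 _ nz; exists [set b | lt0 b z]; split=> //.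
  exists setT; split=> // a _ ca; apply: nz; by exists a.
have /pcard_surjP[g gsurj] := cD.
exists (set_type D), (fun a b => lt0 (set_val a) (set_val b)), (fun a => g (set_val a)).
split.
- move=> a; apply: contrapT => na.
  have [|_ [[b [<- nb]] bmin]] := min0 [set x | exists b : set_type D,
      set_val b = x /\ ~ Acc (fun a b => lt0 (set_val a) (set_val b)) b].
    by exists (set_val a), a.
  apply: nb; constructor=> c cb; apply: contrapT => nc.
  by apply: (bmin _ cb); exists c.
- move=> a b; have [->|/eqP nab] := eqVneq a b; first by constructor 2.
  have nv : set_val a <> set_val b by move=> /val_inj.
  by have /orP[ab|ba] := totR (set_val a) (set_val b);
    [constructor 1|constructor 3; split=> // /esym].
- move=> a b c ab [bc _]; exact: lt0R bc.
- move=> a ca; apply: (segD (set_val a)); first exact: set_valP.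
  apply: card_le_trans ca _; apply/pcard_leP; apply/injfunPex.
  by exists set_val => // b c _ _; exact: val_inj.
- move=> y; have [x Dx gx] := gsurj y Logic.I.
  by exists (SigSub (mem_set Dx)).
Qed.

(** * Types of size at most the continuum, and Borel codes *)

Definition embeds T := exists f : T -> nat -> nat, injective f.

Lemma embeds_count (T : countType) : embeds T.
Proof.
by exists (fun x _ => pickle x) => x y /(congr1 (fun f => f 0)) /(pcan_inj pickleK).
Qed.

Lemma embeds_fun (I : countType) T : embeds T -> embeds (I -> T).
Proof.
move=> [f f_inj].
exists (fun g n => if unpickle n is Some (i, j) then f (g i) j else 0) => g h gh.
apply/funext => i; apply: f_inj; apply/funext => j.
by have := congr1 (fun f => f (pickle (i, j))) gh; rewrite pickleK.
Qed.

Lemma embeds_prod T U : embeds T -> embeds U -> embeds (T * U).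
Proof.
move=> [f f_inj] [g g_inj].
exists (fun x n => if odd n then f x.1 n./2 else g x.2 n./2) => -[x1 x2] [y1 y2] xy.
congr pair; [apply: f_inj|apply: g_inj]; apply/funext => n.
  by have := congr1 (fun f => f n.*2.+1) xy; rewrite /= odd_double /= uphalf_double.
by have := congr1 (fun f => f n.*2) xy; rewrite /= odd_double doubleK.
Qed.

Lemma embeds_surj T : inhabited T -> embeds T ->
  exists g : PN -> T, forall t, exists x, g x = t.
Proof.
move=> [t0] [f f_inj].
pose e t : PN := fun n => if unpickle n is Some (i, j) then f t i == j else false.
have e_inj : injective e.
  move=> t u tu; apply: f_inj; apply/funext => i.
  have := congr1 (fun h => h (pickle (i, f t i))) tu.
  by rewrite /e pickleK eqxx => /esym/eqP.
have /choice[g gP] : forall x, exists t, (exists t', e t' = x) -> e t = x.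
  by move=> x; have [[t tx]|nx] := pselect (exists t, e t = x); [exists t|exists t0 => /nx].
by exists g => t; exists (e t); apply: e_inj; apply: gP; exists t.
Qed.

(** Borel codes as well-founded trees: they allow induction over Borel sets and bound their number
    by the continuum. *)
Inductive code :=
| Cbase of nat
| Ccompl of code
| Cunion of (nat -> code).

(** [Cbase 0] codes the empty set, so that a union over [nat] can skip terms; [Cbase k.+1] codes the
    cylinder of the [k]-th finite sequence. *)
Fixpoint decode (c : code) : set PN :=
  match c with
  | Cbase n => if n isn't k.+1 then set0 else
    if unpickle k is Some s then cyl (nth false s) (size s) else set0
  | Ccompl c => ~` decode c
  | Cunion f => \bigcup_n decode (f n)
  end.

(** The decoded sets form a sigma-algebra, and an open set is the union of the basic cylinders
    inside it. *)
Lemma borel_decode B : borel B -> exists c, decode c = B.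
Proof.
suff sub : <<s (@open PN) >> `<=` [set B | exists c, decode c = B] by exact: sub.
apply: smallest_sub; last first.
  move=> O oO.
  exists (Cunion (fun n => if unpickle n is Some s then
     if `[< cyl (nth false s) (size s) `<=` O >] then Cbase n.+1 else Cbase 0 else Cbase 0)).
  apply/seteqP; split=> [x [n _] /=|x Ox].
    by case: asboolP => [sO|//] /=; exact: sO.
  have [n xn] := open_sub_cyl oO Ox.
  have sx : cyl (nth false (mkseq x n)) (size (mkseq x n)) = cyl x n.
    rewrite size_mkseq; apply/seteqP; split=> y xy i ni.
      by rewrite xy// nth_mkseq.
    by rewrite xy// nth_mkseq.
  exists (pickle (mkseq x n)) => //; rewrite pickleK.
  have -> : `[< cyl (nth false (mkseq x n)) (size (mkseq x n)) `<=` O >].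
    by apply/asboolP; rewrite sx.
  by rewrite /decode pickleK sx.
split.
- by exists (Cbase 0).
- by move=> _ [c <-]; exists (Ccompl c); rewrite setTD.
- move=> F /choice[f fF]; exists (Cunion f) => /=.
  by apply: eq_bigcupr => n _.
Qed.

(** A tree is recovered from the labels along finite paths: the empty path reads the root ([0]
    complement, [1] union, [n.+2] base), and the first entry of a path leads to a child. *)
Lemma embeds_code : embeds code.
Proof.
pose enc := fix enc c (p : seq nat) := match c, p with
  | Cbase n, _ => n.+2
  | Ccompl c, k :: p => enc c p
  | Ccompl c, _ => 0
  | Cunion f, k :: p => enc (f k) p
  | Cunion f, _ => 1 end.
suff enc_inj : injective enc.
  have [f f_inj] := embeds_fun (seq nat) (embeds_count nat).
  by exists (f \o enc); exact: inj_comp.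
elim=> [n|c IHc|f IHf] [m|d|g] cd; have := congr1 (fun h => h [::]) cd => //=.
- by move=> [->].
- move=> _; congr Ccompl; apply: IHc; apply/funext => p.
  exact: (congr1 (fun h => h (0 :: p)) cd).
- move=> _; congr Cunion; apply/funext => k; apply: IHf; apply/funext => p.
  exact: (congr1 (fun h => h (k :: p)) cd).
Qed.

(** * Selections from covers, centered families *)

Lemma nowhere_dense_boundary (O : set PN) : open O -> nowhere_dense (closure O `\` O).
Proof.
move=> oO; apply/nowhere_denseP => x n.
have [[y [xy Oy]]|nO] := pselect (exists y, cyl x n y /\ O y).
  have [m ym] := open_sub_cyl oO Oy.
  exists y, (maxn n m); split; rewrite ?leq_maxl// => z yz [_]; apply; apply: ym.
  by apply: cyl_trans yz; rewrite ?leq_maxr.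
exists x, n; split=> // z xz [/(_ _ (nbhs_cyl z n)) [w [Ow zw]] _].
by apply: nO; exists w; split=> //; exact: cyl_trans zw.
Qed.

(** Induction on the code. For a complement the open set is the complement of the closure, and the
    nowhere dense boundary joins the exceptional set. *)
Lemma baire_property c : exists O M,
  [/\ open O, meager M & forall x, ~ M x -> (decode c x <-> O x)].
Proof.
elim: c => [n|c [O [M [oO mM cO]]]|f IHf].
- exists (decode (Cbase n)), set0; split=> //; last exact: meager0.
  case: n => [|n]; first exact: open0.
  by rewrite /decode; case: unpickle => [s|]; [exact: open_cyl|exact: open0].
- exists (~` closure O), (M `|` (closure O `\` O)); split.
  + by rewrite openC; exact: closed_closure.
  + by apply: meagerU => //; apply: nowhere_dense_meager; exact: nowhere_dense_boundary.
  + move=> x nMx; have dO : decode c x <-> O x by apply: cO => Mx; apply: nMx; left.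
    split=> [nc cOx|ncO /dO/subset_closure//].
    by apply: nMx; right; split=> // /dO.
- move: IHf => /choice[O /choice[M fP]].
  exists (\bigcup_n O n), (\bigcup_n M n); split.
  + by apply: bigcup_open => n _; have [] := fP n.
  + by apply: meager_bigcupT => n; have [] := fP n.
  + move=> x nMx; have nM n : ~ M n x by move=> Mx; apply: nMx; exists n.
    by split=> -[n _ nx]; exists n => //; have [_ _ /(_ x (nM n))[]] := fP n; auto.
Qed.

Definition hits m (A : set PN) := forall x, exists2 y, cyl x m y & A y.

(** [U n k] stands for the [k]-th member of the [n]-th cover, [O n k] for an open set equal to it
    modulo meager. Hitting all cylinders of length [m] leaves room for further generic points. *)
Definition rich (X : set PN) (U O : nat -> nat -> set PN) :=
  forall F : seq PN, (forall x, x \in F -> X x) -> forall n m,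
  exists k, (forall x, x \in F -> U n k x) /\ hits m (O n k).

Definition selects (X : set PN) (U O : nat -> nat -> set PN) (f : nat -> nat) :=
  forall F : seq PN, (forall x, x \in F -> X x) -> forall m,
  exists n, (forall x, x \in F -> U n (f n) x) /\ hits m (O n (f n)).

Definition pickle2 (n k : nat) : nat := pickle (n, k).

(** A generic [r] codes the selection: for fixed [F] and [m] the bad [r] are nowhere dense, and
    smallness of [X] keeps the union over all [F] meager. *)
Lemma exists_selection X U O : small X -> rich X U O -> exists f, selects X U O f.
Proof.
move=> sX rX.
have dec (r : PN) (n : nat) : exists k : nat, forall k', r (pickle2 n k') ->
    (forall j, (j < k')%N -> r (pickle2 n j) = false) -> k = k'.
  have [[k rk]|nr] := pselect (exists k : nat, r (pickle2 n k)); last first.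
    by exists 0 => k rk; exfalso; apply: nr; exists k.
  have ex : exists k : nat, r (pickle2 n k) by exists k.
  exists (ex_minn ex) => k' rk' rlt; case: ex_minnP => m rm mmin.
  apply/eqP; rewrite eqn_leq mmin//= leqNgt; apply/negP => /rlt.
  by rewrite rm.
(* [g r n] is the least [k] with [(n, k)] in [r]. *)
have /choice[g gP] : forall r : PN, exists f : nat -> nat, forall n k : nat, r (pickle2 n k) ->
    (forall j, (j < k)%N -> r (pickle2 n j) = false) -> f n = k.
  by move=> r; have /choice[f fP] := dec r; exists f.
pose bad (F : seq PN) m := [set r |
  ~ exists n, (forall x, x \in F -> U n (g r n) x) /\ hits m (O n (g r n))].
have mB : meager (\bigcup_(F in [set F : seq PN | forall x, x \in F -> X x]) \bigcup_m bad F m).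
  apply: (small_seq sX) => F FX; apply: meager_bigcupT => m.
  apply/nowhere_dense_meager/nowhere_denseP => x n0.
  (* Row [N] has no pair coded below [n0], so the first [n0] coordinates leave the choice in this
     row free. *)
  pose N := \max_(i < n0) if (unpickle i : option (nat * nat)) is Some (p, _) then p.+1 else 0.
  have Nge j : (n0 <= pickle2 N j)%N.
    rewrite leqNgt; apply/negP => lt_n0.
    have := @leq_bigmax _ (fun i : 'I_n0 =>
      if (unpickle i : option (nat * nat)) is Some (p, _) then p.+1 else 0) (Ordinal lt_n0).
    by rewrite /= /pickle2 pickleK -/N ltnn.
  have [k [Fk hk]] := rX F FX N m.
  (* The cylinder shows a single one among the first [k.+1] entries of row [N], at [k]; hence
     [g z N = k] for all [z] in it. *)
  pose y : PN := fun i => if (i < n0)%N then x i else i == pickle2 N k.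
  exists y, (maxn n0 (\max_(j < k.+1) (pickle2 N j).+1)); split.
  - exact: leq_maxl.
  - by move=> i ni; rewrite /y ni.
  - move=> z yz; apply; exists N.
    have zy j : (j <= k)%N -> z (pickle2 N j) = (j == k).
      move=> jk; rewrite yz; last first.
        rewrite leq_max; apply/orP; right; rewrite -ltnS in jk.
        exact: (@leq_bigmax _ (fun j : 'I_k.+1 => (pickle2 N j).+1) (Ordinal jk)).
      rewrite /y ltnNge Nge /=; apply/eqP/eqP => [|->//].
      by move=> /(pcan_inj pickleK) [].
    have -> // : g z N = k.
    apply: gP; first by rewrite zy ?eqxx.
    by move=> j jk; rewrite zy ?(ltnW jk)// ltn_eqF.
have [r _ nr] := baire (fun=> false) 0 mB.
exists (g r) => F FX m; apply: contrapT => nF; apply: nr.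
by exists F => //; exists m.
Qed.

Definition unextendable X (U O : nat -> nat -> set PN) f : set PN :=
  [set x | exists (F : seq PN) m, (forall y, y \in F -> X y) /\
    ~ exists n, [/\ forall y, y \in F -> U n (f n) y, hits m (O n (f n)) & O n (f n) x]].

(** In a cylinder of length [n], use an index whose open set meets all cylinders of length
    [maxn m n]: it hits those of length [m] and contains a subcylinder of the given one. *)
Lemma meager_unextendable X U O f : small X -> (forall n k, open (O n k)) ->
  selects X U O f -> meager (unextendable X U O f).
Proof.
move=> sX oO sel.
pose bad (F : seq PN) m : set PN :=
  [set x | ~ exists n, [/\ forall y, y \in F -> U n (f n) y, hits m (O n (f n)) & O n (f n) x]].
apply: (@sub_meager _ (\bigcup_(F in [set F : seq PN | forall x, x \in F -> X x])
    \bigcup_m bad F m)).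
  by move=> x [F [m [FX nF]]]; exists F => //; exists m.
apply: (small_seq sX) => F FX; apply: meager_bigcupT => m.
apply/nowhere_dense_meager/nowhere_denseP => x n.
have [k [Fk hk]] := sel F FX (maxn m n).
have [y xy Oy] := hk x.
have [l yl] := open_sub_cyl (oO _ _) Oy.
exists y, (maxn n l); split; first exact: leq_maxl.
  by move=> i ni; apply: xy; rewrite leq_max ni orbT.
move=> z yz; apply; exists k; split=> //; last first.
  by apply: yl; apply: cyl_trans yz; rewrite ?leq_maxr.
move=> w; have [v wv Ov] := hk w; exists v => // i im.
by apply: wv; rewrite leq_max im.
Qed.

Lemma selects_extend X U O f x : ~ unextendable X U O f x ->
  (forall n k, O n k x -> U n k x) -> selects (X `|` [set x]) U O f.
Proof.
move=> nx OU F FX m; apply: contrapT => nF; apply: nx.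
exists [seq y <- F | y != x], m; split=> [y|[n [Fn hn On]]].
  by rewrite mem_filter => /andP[/eqP yx /FX[]].
apply: nF; exists n; split=> // y yF; have [->|yx] := eqVneq y x; first exact: OU.
by apply: Fn; rewrite mem_filter yx.
Qed.

(** * Centered families: the strong finite intersection property *)

Definition centered (K : set PN) := forall F : seq PN, (forall x, x \in F -> K x) ->
  forall m, exists2 n, (m <= n)%N & forall x, x \in F -> x n.

Definition centered_in (K : set PN) (z : PN) := forall F : seq PN, (forall x, x \in F -> K x) ->
  forall m, exists n, [/\ (m <= n)%N, z n & forall x, x \in F -> x n].

(** If both choices failed, the two finite witnesses together would have a common element beyond
    both bounds, and it lies in [y] or outside it. *)
Lemma centered_split K y : centered K ->
  exists z : PN, (z = y \/ z = fun n => ~~ y n) /\ centered_in K z.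
Proof.
move=> cK; apply: contrapT => nz.
have /existsNP[F1 /not_implyP[F1K /existsNP[m1 n1]]] : ~ centered_in K y.
  by move=> cy; apply: nz; exists y; split=> //; left.
have /existsNP[F2 /not_implyP[F2K /existsNP[m2 n2]]] : ~ centered_in K (fun n => ~~ y n).
  by move=> cy; apply: nz; exists (fun n => ~~ y n); split=> //; right.
have [|n mn Fn] := cK (F1 ++ F2) _ (maxn m1 m2).
  by move=> x; rewrite mem_cat => /orP[/F1K|/F2K].
move: mn; rewrite geq_max => /andP[mn1 mn2].
case yn : (y n).
  by apply: n1; exists n; split=> // x xF; apply: Fn; rewrite mem_cat xF.
by apply: n2; exists n; rewrite yn; split=> // x xF; apply: Fn; rewrite mem_cat xF orbT.
Qed.

(* For generic [c], [a = ptw z false c] and [b = ptw z true c] are generic points whose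
   intersection lies in [z]: [a n] is [c (2n)], and [b n] is [c (2n+1)] if [n] is in [z] and
   the negation of [a n] otherwise. *)
Definition pflip (z : PN) (i : bool) n := i && ~~ z n.
Definition pcoord (z : PN) (i : bool) n := if i && z n then n.*2.+1 else n.*2.
Definition ptw z i := twist (pflip z i) (pcoord z i).

Lemma pcoord_inj z i : injective (pcoord z i).
Proof.
move=> m n; rewrite /pcoord => mn.
have := congr1 half mn; by case: ifP => _; case: ifP => _; rewrite /= ?uphalf_double ?doubleK.
Qed.

Lemma pcoord_ge z i n : (n <= pcoord z i n)%N.
Proof. by rewrite /pcoord -addnn; case: ifP => _; rewrite ?leqW ?leq_addr. Qed.

Lemma ptw_sub z c n : ptw z false c n -> ptw z true c n -> z n.
Proof.
by rewrite /ptw /twist /pflip /pcoord /=; case: (z n) => //=; case: (c _).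
Qed.

(** For [n] in [z], the points [ptw z false c] and [ptw z true c] contain [n] exactly when [c n.*2]
    and [c n.*2.+1] hold; off this set both can be added to [K]. *)
Definition uncentered K (z : PN) : set PN := [set c |
  exists (F : seq PN) m, (forall x, x \in F -> K x) /\
  ~ exists n, [/\ (m <= n)%N, forall x, x \in F -> x n, z n, c n.*2 & c n.*2.+1]].

Lemma meager_uncentered K z : small K -> centered_in K z -> meager (uncentered K z).
Proof.
move=> sK cK.
pose bad (F : seq PN) m : set PN :=
  [set c | ~ exists n, [/\ (m <= n)%N, forall x, x \in F -> x n, z n, c n.*2 & c n.*2.+1]].
apply: (@sub_meager _ (\bigcup_(F in [set F : seq PN | forall x, x \in F -> K x])
    \bigcup_m bad F m)).
  by move=> x [F [m [FX nF]]]; exists F => //; exists m.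
apply: (small_seq sK) => F FX; apply: meager_bigcupT => m.
apply/nowhere_dense_meager/nowhere_denseP => x n.
have [k [kmn zk Fk]] := cK F FX (maxn m n).
have [km kn] : (m <= k /\ n <= k)%N by apply/andP; rewrite -geq_max.
exists (fun i => if (i < n)%N then x i else true), (maxn n k.*2.+2); split; first exact: leq_maxl.
  by move=> i ->.
move=> c yc; apply; exists k.
have nk : (n <= k.*2)%N by rewrite -addnn (leq_trans kn)// leq_addr.
by split=> //; rewrite yc ?leq_max ?leqnn ?leqnSn ?orbT// ltnNge ?nk ?leqW.
Qed.

Lemma centered_extend K z c : ~ uncentered K z c ->
  centered (K `|` range (fun i => ptw z i c)).
Proof.
move=> nc F FK m; apply: contrapT => nF; apply: nc.
exists [seq x <- F | `[< K x >]], m; split=> [x|[n [mn Fn zn c0 c1]]].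
  by rewrite mem_filter => /andP[/asboolP].
apply: nF; exists n => // x xF; have [Kx|[i _ <-]] := FK _ xF.
  by apply: Fn; rewrite mem_filter xF andbT; apply/asboolP.
by rewrite /ptw /twist /pflip /pcoord zn andbF andbT; case: i.
Qed.

(** * The transfinite construction *)

(** [pick] chooses a witness for the history truncated by [rest] to earlier stages; as [R a] depends
    on these only, the truncation can be exchanged for the final [h]. *)
Lemma transfinite_choice S (lt : S -> S -> Prop) V (v0 : V) (R : S -> (S -> V) -> V -> Prop) :
  well_founded lt ->
  (forall a h h' v, (forall b, lt b a -> h b = h' b) -> R a h v -> R a h' v) ->
  (forall a h, (forall b, lt b a -> R b h (h b)) -> exists v, R a h v) ->
  exists h, forall a, R a h (h a).
Proof.
move=> wf Rext Rex.
pose pick a h := if pselect (exists v, R a h v) is left e then projT1 (cid e) else v0.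
pose rest a (h : forall b, lt b a -> V) b := if pselect (lt b a) is left p then h b p else v0.
pose h := Fix wf (fun=> V) (fun a rec => pick a (rest a rec)).
have hE a : h a = pick a (rest a (fun b _ => h b)).
  rewrite /h Fix_eq// => b f g fg; congr (pick b (rest b _)).
  by apply: functional_extensionality_dep => c; apply/funext => p.
exists h; elim/(well_founded_ind wf) => a IHa.
have ra b : lt b a -> rest a (fun b _ => h b) b = h b.
  by rewrite /rest; case: pselect.
have [v hv] := Rex a h IHa.
rewrite hE /pick; case: pselect => [e|[]]; last first.
  by exists v; apply: Rext hv => b /ra.
by case: cid => w /=; apply: Rext => b /ra.
Qed.

Section construction.
Variables (S : eqType) (lt : S -> S -> Prop).
Hypothesis wf_lt : well_founded lt.
Hypothesis tot_lt : forall a b, [\/ lt a b, a = b | lt b a].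
Hypothesis tr_lt : forall a b c, lt a b -> lt b c -> lt a c.
Hypothesis small_lt : forall a, small [set b | lt b a].

Let le a b := lt a b \/ a = b.

Let le_refl a : le a a. Proof. by right. Qed.

Let le_trans a b c : le a b -> le b c -> le a c.
Proof. by move=> [ab|->] [bc|<-]; rewrite /le; auto; left; exact: tr_lt bc. Qed.

Let le_total a b : le a b \/ le b a.
Proof. by rewrite /le; have [] := tot_lt a b; auto. Qed.

Let small_le a : small [set b | le b a].
Proof.
apply: (@sub_small _ _ ([set b | lt b a] `|` [set a])).
  by move=> b [ba|->]; [left|right].
exact: smallU (@small_lt a) (@small1 _ a).
Qed.

(** The requirements on stages speak of finite sets of points, and such a set already appears at one
    stage; so limit stages need no separate argument. *)
Let directed (D : set S) (G : S -> set PN) b (F : seq PN) :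
  (forall c d, le c d -> G c `<=` G d) -> D b ->
  (forall x, x \in F -> exists2 c, D c & G c x) ->
  exists c, [/\ D c, le b c & forall x, x \in F -> G c x].
Proof.
move=> mG Db; elim: F => [|x F IHF] FD; first by exists b.
have [|c [Dc bc Fc]] := IHF; first by move=> y yF; apply: FD; rewrite in_cons yF orbT.
have [|d Dd xd] := FD x; first by rewrite mem_head.
have [cd|dc] := le_total c d.
  exists d; split=> //; first exact: le_trans cd.
  by move=> y; rewrite in_cons => /predU1P[->//|/Fc]; exact: mG.
by exists c; split=> // y; rewrite in_cons => /predU1P[->//|/Fc//]; exact: mG xd.
Qed.

Variables (side : S -> bool) (sx : S -> PN) (sn : S -> nat) (y : S -> PN) (M : S -> set PN).
Variables U O : S -> nat -> nat -> set PN.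
Hypothesis meagerM : forall a, meager (M a).
Hypothesis openO : forall a n k, open (O a n k).
Hypothesis subOU : forall a n k x, ~ M a x -> O a n k x -> U a n k x.

(** A stage yields, for each side, a new point and a selection from the covers attached to that
    stage. *)
Let V := ((bool -> PN) * (bool -> nat -> nat))%type.
Let below (h : S -> V) i a : set PN := [set x | exists2 b, lt b a & x = (h b).1 i].
Let upto (h : S -> V) i a : set PN := [set x | exists2 b, le b a & x = (h b).1 i].
Let all_below (h : S -> V) a : set PN := [set x | exists2 b, lt b a & exists i, x = (h b).1 i].
Let all_upto (h : S -> V) a : set PN := [set x | exists2 b, le b a & exists i, x = (h b).1 i].

(** The last clause keeps alive the selections from all covers that were rich over the points
    present before their own stage [b]; the test [b == a] tells the new selection from the old
    ones. *)
Let stage (a : S) (h : S -> V) (v : V) : Prop :=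
  [/\ forall i b, le b a -> ~ M b (v.1 i),
      centered (all_below h a `|` range v.1),
      exists z : PN, (z = y a \/ z = fun n => ~~ y a n) /\
        forall n, v.1 false n -> v.1 true n -> z n,
      cyl (sx a) (sn a) (v.1 (side a)) &
      forall i b, le b a -> rich (below h i b) (U b) (O b) ->
        selects (below h i a `|` [set v.1 i]) (U b) (O b) (if b == a then v.2 i else (h b).2 i)].

Let stage_ext a h h' v : (forall b, lt b a -> h b = h' b) -> stage a h v -> stage a h' v.
Proof.
move=> hh' [H1 H2 H3 H4 H5].
have bE i b : le b a -> below h i b = below h' i b.
  move=> ba; apply/seteqP; split=> x [c cb ->]; exists c => //.
    by rewrite hh'//; case: ba => [|<-//]; exact: tr_lt.
  by rewrite hh'//; case: ba => [|<-//]; exact: tr_lt.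
have abE : all_below h a = all_below h' a.
  by apply/seteqP; split=> x [c cb [i ->]]; exists c => //; exists i; rewrite hh'.
split=> //; first by rewrite -abE.
move=> i b ba; rewrite -!bE// => /(H5 i b ba).
by case: eqP => // nba; rewrite hh'//; case: ba.
Qed.

Let upto_mono h i c d : le c d -> upto h i c `<=` upto h i d.
Proof. by move=> cd x [b bc ->]; exists b => //; exact: le_trans cd. Qed.

Let all_upto_mono h c d : le c d -> all_upto h c `<=` all_upto h d.
Proof. by move=> cd x [b bc xb]; exists b => //; exact: le_trans cd. Qed.

Let uptoE h i c : upto h i c `<=` below h i c `|` [set (h c).1 i].
Proof. by move=> x [b [bc|->] ->]; [left; exists b|right]. Qed.

Let all_uptoE h c : all_upto h c `<=` all_below h c `|` range (h c).1.
Proof. by move=> x [b [bc|->] [i ->]]; [left; exists b => //; exists i|right; exists i]. Qed.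

Let centered_below a h : (forall b, lt b a -> stage b h (h b)) -> centered (all_below h a).
Proof.
move=> IH F Fa m; case: F Fa => [|x0 F] Fa; first by exists m.
have [b ba _] := Fa x0 (mem_head _ _).
have [|c [ca _ Fc]] := @directed [set b | lt b a] (all_upto h) b (x0 :: F) (@all_upto_mono h) ba.
  by move=> x /Fa [d da xd]; exists d => //; exists d.
have [_ cc _ _ _] := IH c ca.
by apply: cc => x /Fc /all_uptoE.
Qed.

Let selects_below a h i b : (forall b, lt b a -> stage b h (h b)) -> lt b a ->
  rich (below h i b) (U b) (O b) -> selects (below h i a) (U b) (O b) ((h b).2 i).
Proof.
move=> IH ba rb F Fa m.
have [|c [ca bc Fc]] := @directed [set b | lt b a] (upto h i) b F (@upto_mono h i) ba.
  by move=> x /Fa [d da xd]; exists d => //; exists d.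
have [_ _ _ _ /(_ i b bc rb) sc] := IH c ca.
have -> : (h b).2 i = if b == c then (h c).2 i else (h b).2 i by case: eqP => [->|].
by apply: sc => x /Fc /uptoE.
Qed.

(** Entering the prescribed cylinder is arranged by starting inside a suitable one; every other
    requirement on the points excludes a meager set of [c], so one generic [c] gives both points. *)
Let stage_ex a h : (forall b, lt b a -> stage b h (h b)) -> exists v, stage a h v.
Proof.
move=> IH.
have small_below i : small (below h i a).
  apply: (@sub_small _ _ ((fun b => (h b).1 i) @` [set b | lt b a])).
    by move=> x [b ba ->]; exists b.
  exact: small_image (@small_lt a).
have small_all : small (all_below h a).
  apply: (@sub_small _ _ (below h false a `|` below h true a)); last exact: smallU.
  by move=> x [b ba [[] ->]]; [right|left]; exists b.
have /choice[f fP] : forall i, exists f, rich (below h i a) (U a) (O a) ->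
    selects (below h i a) (U a) (O a) f.
  move=> i; have [ra|nra] := pselect (rich (below h i a) (U a) (O a)); last by exists (fun=> 0).
  by have [f fP] := exists_selection (small_below i) ra; exists f.
pose sel i b := if b == a then f i else (h b).2 i.
have selP i b : le b a -> rich (below h i b) (U b) (O b) ->
    selects (below h i a) (U b) (O b) (sel i b).
  rewrite /sel; case: eqP => [-> _|nba [ba rb|//]]; first exact: fP.
  exact: (selects_below IH).
have [z [yz cz]] := centered_split (y a) (centered_below IH).
pose bad i : set PN := \bigcup_(b in [set b | le b a])
  (M b `|` if pselect (rich (below h i b) (U b) (O b)) is left _
           then unextendable (below h i a) (U b) (O b) (sel i b) else set0).
have meager_bad : meager (uncentered (all_below h a) z `|`
    \bigcup_(i : bool) (ptw z i @^-1` bad i)).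
  apply: meagerU; first exact: meager_uncentered.
  apply: meager_bigcup_count => i; apply: meager_twist (@pcoord_inj z i) (@pcoord_ge z i) _ _.
  apply: (@small_le a) => b ba; apply: meagerU; first exact: meagerM.
  case: pselect => [rb|_]; last exact: meager0.
  by apply: meager_unextendable; [exact: small_below|exact: openO|exact: selP].
(* [ptw z (side a)] maps [cyl c0 l] into the cylinder required at stage [a]; the lift starts from
   the empty condition, of length [0]. *)
have [c0 [l [_ _ c0P]]] := @twist_lift (pflip z (side a)) _
  (@pcoord_inj z (side a)) (@pcoord_ge z (side a)) (fun=> false) 0 (sx a) (sn a) (leq0n _)
  (fun i (i0 : (i < 0)%N) => False_rect _ (notF i0)).
have [c c0c nbad] := baire c0 l meager_bad.
have nb i b : le b a -> ~ M b (ptw z i c) /\ (rich (below h i b) (U b) (O b) ->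
    ~ unextendable (below h i a) (U b) (O b) (sel i b) (ptw z i c)).
  move=> ba; split=> [Mb|rb ub]; apply: nbad; right; exists i => //; exists b => //; first by left.
  by right; case: pselect.
exists (fun i => ptw z i c, f); split=> /=.
- by move=> i b ba; have [] := nb i b ba.
- by apply: centered_extend => uc; apply: nbad; left.
- by exists z; split=> // n; exact: ptw_sub.
- exact: c0P.
- move=> i b ba rb; apply: selects_extend; first by have [_] := nb i b ba; apply.
  by move=> n k; apply: subOU; have [] := nb i b ba.
Qed.

(** The first clause will give the Luzin property: only points of stages before [b] can lie in
    [M b]. In the last, richness over the points before stage [a] yields a selection good for all
    points. *)
Lemma construction : exists (pt : S -> bool -> PN) (sel : S -> bool -> nat -> nat),
  [/\ forall a b i, ~ lt a b -> ~ M b (pt a i),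
      centered [set x | exists a i, x = pt a i],
      forall a, exists z : PN, (z = y a \/ z = fun n => ~~ y a n) /\
        forall n, pt a false n -> pt a true n -> z n,
      forall a, cyl (sx a) (sn a) (pt a (side a)) &
      forall a i, rich [set x | exists2 b, lt b a & x = pt b i] (U a) (O a) ->
        selects [set x | exists b, x = pt b i] (U a) (O a) (sel a i)].
Proof.
have [h hP] := transfinite_choice ((fun _ _ => false), (fun _ _ => 0)) wf_lt stage_ext stage_ex.
exists (fun a => (h a).1), (fun a => (h a).2); split.
- move=> a b i nab; have [H _ _ _ _] := hP a; apply: H.
  by have [//|->|] := tot_lt a b; [right|left].
- move=> F Fa m; case: F Fa => [|x0 F] Fa; first by exists m.
  have [b _] := Fa x0 (mem_head _ _).
  have [|c [_ _ Fc]] := @directed setT (all_upto h) b (x0 :: F) (@all_upto_mono h) Logic.I.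
    by move=> x /Fa [d [i xd]]; exists d => //; exists d => //; exists i.
  have [_ cc _ _ _] := hP c.
  by apply: cc => x /Fc /all_uptoE.
- by move=> a; have [] := hP a.
- by move=> a; have [] := hP a.
- move=> a i ra F Fa m.
  have [|c [_ ac Fc]] := @directed setT (upto h i) a F (@upto_mono h i) Logic.I.
    by move=> x /Fa [d xd]; exists d => //; exists d.
  have [_ _ _ _ /(_ i a ac ra) sc] := hP c.
  have -> : (h a).2 i = if a == c then (h c).2 i else (h a).2 i by case: eqP => [->|].
  by apply: sc => x /Fc /uptoE.
Qed.

End construction.

(** * Splitting large covers *)

Lemma finite_set_bounded (A : set nat) : finite_set A -> exists p, forall n, A n -> (n < p)%N.
Proof.
move=> /finite_seqP[s ->]; exists (\max_(i <- s) i).+1 => n /= ns.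
by rewrite ltnS; exact: (@leq_bigmax_seq _ s xpredT id).
Qed.

Lemma countable_infinite_enum (T : pointedType) (U : set T) : countable U -> ~ finite_set U ->
  exists e : nat -> T, injective e /\ U = range e.
Proof.
move=> cU iU; have /pcard_eqP : ([set: nat] #= U)%card by rewrite card_eq_sym; exact: eq_card_nat.
move=> [e]; exists e; split; first by move=> i j eij; apply: (@inj _ _ _ e); rewrite ?inE.
by rewrite eqEsubset; split=> [x /(@surj _ _ _ _ e)//|_ [n _ <-]]; exact: (@funS _ _ _ _ e).
Qed.

Definition everywhere_nonmeager (X : set PN) := forall M x n, meager M ->
  exists y, [/\ X y, cyl x n y & ~ M y].

Definition frequently (P : nat -> Prop) := forall p, exists2 n, (p <= n)%N & P n.

Section splitting_large_covers.
Variables (X : set PN) (e : nat -> set PN).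
Hypothesis nmX : everywhere_nonmeager X.
Hypothesis smallX : forall M, meager M -> small (X `&` M).
Hypothesis borel_e : forall n, borel_in X (e n).
Hypothesis large_e : forall x, X x -> frequently (fun n => e n x).

Lemma frequently_split : exists A : nat -> bool, forall x, X x ->
  frequently (fun n => e n x /\ A n) /\ frequently (fun n => e n x /\ ~~ A n).
Proof.
have /choice[O /choice[M OMP]] : forall n, exists O M, [/\ open O, meager M &
    forall x, X x -> ~ M x -> (e n x <-> O x)].
  move=> n; have [B [/borel_decode[c <-] ->]] := borel_e n.
  have [O [M [oO mM cO]]] := baire_property c; exists O, M; split=> // x Xx /cO <-.
  by split=> [[]|].
have oO n : open (O n) by have [] := OMP n.
pose M' := \bigcup_n M n.
have mM' : meager M' by apply: meager_bigcupT => n; have [] := OMP n.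
have eO n x : X x -> ~ M' x -> (e n x <-> O n x).
  by move=> Xx nM; have [_ _] := OMP n; apply=> // Mx; apply: nM; exists n.
(* The points [z k] are taken in all basic cylinders, hence dense, and off [M'], so that [e n] and
   [O n] agree on them. *)
have /choice[z zP] : forall k : nat, exists y, [/\ X y, ~ M' y &
    forall s : seq bool, unpickle k = Some s -> cyl (nth false s) (size s) y].
  move=> k; case: (unpickle k : option (seq bool)) => [s|].
    by have [y [Xy sy nM]] := nmX (nth false s) (size s) mM'; exists y; split=> // _ [<-].
  by have [y [Xy _ nM]] := nmX (fun=> false) 0 mM'; exists y.
have zdense x n : exists i, cyl x n (z i).
  exists (pickle (mkseq x n)) => i ni; have [_ _ zs] := zP (pickle (mkseq x n)).
  by rewrite (zs (mkseq x n)) ?pickleK ?size_mkseq// nth_mkseq.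
have zO i p : exists2 n, (p <= n)%N & O n (z i).
  have [Xz nM _] := zP i; have [n pn ez] := large_e Xz p.
  by exists n => //; apply/eO.
(* A block from [p] to [q (p, k)] is long enough to catch each [z i] with [i <= k] in some [O n]. *)
have /choice[q qP] : forall pk : nat * nat, exists q, (pk.1 < q)%N /\
    forall i, (i <= pk.2)%N -> exists n, [/\ (pk.1 <= n)%N, (n < q)%N & O n (z i)].
  move=> [p k] /=; have /choice[g gP] : forall i, exists n, (p <= n)%N /\ O n (z i).
    by move=> i; have [n] := zO i p; exists n.
  exists (\max_(i < k.+1) (g i).+1); split.
    apply: leq_trans (@leq_bigmax _ (fun i : 'I_k.+1 => (g i).+1) ord0).
    by rewrite ltnS; have [] := gP (ord0 : 'I_k.+1).
  move=> i ik; have [pg Og] := gP i; exists (g i); split=> //.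
  exact: (@leq_bigmax _ (fun i : 'I_k.+1 => (g i).+1) (Ordinal (ik : (i < k.+1)%N))).
pose p := fix p j := if j is i.+1 then q (p i, i) else 0.
have p_lt j : (p j < p j.+1)%N by have [] := qP (p j, j).
have p_homo i j : (i <= j)%N -> (p i <= p j)%N.
  by apply: (@homo_leq _ p leq) => // [a b c|k]; [exact: leq_trans|exact: ltnW].
have p_ge j : (j <= p j)%N by elim: j => // j IHj; exact: leq_ltn_trans (p_lt j).
have /choice[blk blkP] : forall n, exists j, (p j <= n < p j.+1)%N.
  elim=> [|n [j /andP[jn nj]]]; first by exists 0; rewrite /= (p_lt 0).
  have [nj'|nj'] := ltnP n.+1 (p j.+1); first by exists j; rewrite nj' leqW.
  by exists j.+1; rewrite nj' (leq_ltn_trans nj (p_lt _)).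
have blkE n j : (p j <= n < p j.+1)%N -> blk n = j.
  move=> /andP[jn nj]; have /andP[bn nb] := blkP n.
  apply/eqP; rewrite eqn_leq; apply/andP; split; rewrite -ltnS ltnNge; apply/negP => /p_homo.
    by rewrite leqNgt (leq_ltn_trans bn nj).
  by rewrite leqNgt (leq_ltn_trans jn nb).
have blk_ge n j : (p j <= n)%N -> (j <= blk n)%N.
  move=> jn; rewrite -ltnS ltnNge; apply/negP => /p_homo; rewrite leqNgt.
  by have /andP[_ nb] := blkP n; rewrite (leq_ltn_trans jn nb).
pose E j : set PN := [set x | exists2 n, blk n = j & O n x].
have Ez i j : (i <= j)%N -> E j (z i).
  move=> ij; have [_ /(_ i ij)[n [jn nj Oz]]] := qP (p j, j).
  by exists n => //; apply: blkE; rewrite jn.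
have oE j x : E j x -> exists n, cyl x n `<=` E j.
  move=> [n bn Ox]; have [m xm] := open_sub_cyl (oO n) Ox.
  by exists m => y /xm Oy; exists n.
(* Every cylinder contains some [z i], which lies in the open sets [E j] for all [j >= i]; for large
   [k] a neighborhood of [z i] is inside both [E k.*2] and [E k.*2.+1]. *)
pose N := \bigcup_k0 [set x | ~ exists k, [/\ (k0 <= k)%N, E k.*2 x & E k.*2.+1 x]].
have mN : meager N.
  apply: meager_bigcupT => k0; apply/nowhere_dense_meager/nowhere_denseP => x n.
  have [i xz] := zdense x n; pose k := maxn k0 i.
  have ik : (i <= k.*2)%N by rewrite -addnn (leq_trans (leq_maxr k0 i))// leq_addr.
  have [m1 E1] := oE _ _ (Ez i _ ik); have [m2 E2] := oE _ _ (Ez i _ (leqW ik)).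
  exists (z i), (maxn n (maxn m1 m2)); split=> //; first exact: leq_maxl.
  move=> y zy; apply; exists k; split; first exact: leq_maxl.
    by apply: E1; apply: cyl_trans zy; rewrite // !leq_max leqnn orbT.
  by apply: E2; apply: cyl_trans zy; rewrite // !leq_max leqnn !orbT.
(* The bit [r k] decides which of the blocks [2k] and [2k+1] goes to [A]: the odd one if it is
   true. *)
pose A (r : PN) n := odd (blk n) == r (blk n)./2.
pose bad x := \bigcup_k0 \bigcup_(b : bool) [set r |
   ~ exists n, [/\ (k0 <= n)%N, e n x & A r n == b]].
have mbad : meager (\bigcup_(x in X `&` (M' `|` N)) bad x).
  apply: (smallX (meagerU mM' mN)) => x [Xx _]; apply: meager_bigcupT => k0.
  apply: meager_bigcup_count => b; apply/nowhere_dense_meager/nowhere_denseP => y n0.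
  have [n + ex] := large_e Xx (maxn k0 (p n0.*2)); rewrite geq_max => /andP[k0n pn].
  have n0b : (n0 <= (blk n)./2)%N by rewrite -[n0]doubleK; apply/half_leq/blk_ge.
  (* The bit at [(blk n)./2], still free because [n0 <= (blk n)./2], sends [n] to side [b]. *)
  exists (fun i => if (i < n0)%N then y i else odd (blk n) == b), (maxn n0 (blk n)./2.+1).
  split; [exact: leq_maxl|by move=> i ->|].
  move=> r yr; apply; exists n; split=> //.
  rewrite /A yr ?leq_max ?leqnn ?orbT// ltnNge n0b /=.
  by case: (odd _); case: (b).
have [r _ nr] := baire (fun=> false) 0 mbad.
exists (A r) => x Xx.
suff sp b : frequently (fun n => e n x /\ A r n = b).
  by split; [exact: (sp true)|move=> k; have [n kn [en /negbT An]] := sp false k; exists n].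
move=> k0; have [bx|gx] := pselect ((M' `|` N) x).
  apply: contrapT => nk; apply: nr; exists x => //; exists k0 => //.
  exists b => // -[n [kn ex /eqP An]].
  by apply: nk; exists n.
have nM : ~ M' x by move=> ?; apply: gx; left.
have [k [k0k [n0 b0 O0] [n1 b1 O1]]] : exists k, [/\ (k0 <= k)%N, E k.*2 x & E k.*2.+1 x].
  by apply: contrapT => nk; apply: gx; right; exists k0.
have ge_k0 n j : blk n = j -> (k.*2 <= j)%N -> (k0 <= n)%N.
  move=> bn kj; have /andP[pn _] := blkP n; apply: leq_trans k0k (leq_trans _ pn).
  by apply: leq_trans (p_ge _); rewrite bn (leq_trans _ kj)// -addnn leq_addr.
(* Exactly one block of pair [k] is on side [b]: the odd one if [b = r k], else the even one. *)
have [rk|rk] := eqVneq b (r k).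
  exists n1; first exact: ge_k0 b1 _.
  split; first exact/eO.
  by rewrite /A b1 /= odd_double uphalf_double -rk; case: b {rk}.
exists n0; first exact: ge_k0 b0 _.
split; first exact/eO.
by rewrite /A b0 odd_double doubleK; move: rk; case: b; case: (r k).
Qed.

End splitting_large_covers.

Lemma borel_in_sub X B : borel_in X B -> B `<=` X.
Proof. by move=> [B' [_ ->]] x []. Qed.

Lemma split_B_Lambda X : everywhere_nonmeager X ->
  (forall M, meager M -> small (X `&` M)) -> Split_sel B_Lambda B_Lambda X.
Proof.
move=> nmX smallX U [cU [bU [[UX nUX] lU]]].
have [x0 [Xx0 _ _]] := nmX set0 (fun=> false) 0 meager0.
have iU : ~ finite_set U.
  by move=> fU; apply: (lU x0 Xx0); apply: sub_finite_set fU => V [].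
have [e [e_inj UE]] := countable_infinite_enum cU iU.
have Ue n : U (e n) by rewrite UE; exists n.
have large_e x : X x -> frequently (fun n => e n x).
  move=> Xx p; apply: contrapT => np; apply: (lU x Xx).
  apply: (@sub_finite_set _ _ (e @` `I_p)); last exact/finite_image/finite_II.
  move=> V; rewrite UE => -[[n _ <-] en]; exists n => //=.
  by rewrite ltnNge; apply/negP => pn; apply: np; exists n.
have [A AP] := frequently_split nmX smallX (fun n => bU _ (Ue n)) large_e.
have sub_large (P : nat -> Prop) : (forall x, X x -> frequently (fun n => e n x /\ P n)) ->
    B_Lambda X (e @` [set n | P n]).
  move=> freqP.
  have sU : e @` [set n | P n] `<=` U by move=> _ [n _ <-].
  split; first exact: sub_countable (subset_card_le sU) cU.
  split; first by move=> V /sU/bU.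
  split; first split; last 1 first.
  - move=> x Xx fx.
    have /finite_set_bounded[p pP] : finite_set [set n | e n x /\ P n].
      have eqc : (e @` [set n | e n x /\ P n] #= [set n | e n x /\ P n])%card.
        by apply: inj_card_eq => i j _ _; exact: e_inj.
      rewrite -(eq_finite_set eqc); apply: sub_finite_set fx.
      by move=> _ [n [en Pn] <-]; split=> //; exists n.
    have [n pn nP] := freqP x Xx p.
    by have := pP n nP; rewrite ltnNge pn.
  - apply/seteqP; split=> [x [V /sU/bU/borel_in_sub VX]|x Xx]; first exact: VX.
    by have [n _ [en Pn]] := freqP x Xx 0; exists (e n) => //; exists n.
  - by move=> V /sU/nUX.
exists (e @` [set n | A n]), (e @` [set n | ~~ A n]); split.
- rewrite UE; apply/seteqP; split=> [V [] [n _ <-]|_ [n _ <-]]; [by exists n|by exists n|].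
  by case An : (A n); [left|right]; exists n; rewrite //= An.
- apply/seteqP; split=> // _ [[n An <-] [m nAm /e_inj mn]].
  by move: nAm; rewrite /= mn An.
- exists (e @` [set n | A n]); split=> //; apply: (sub_large (fun n => A n)) => x /AP[].
  by [].
- exists (e @` [set n | ~~ A n]); split=> //; apply: (sub_large (fun n => ~~ A n)) => x /AP[].
  by [].
Qed.

(** * Splitting omega-covers *)

Lemma borelT : borel setT.
Proof. exact: (@measurableT _ (g_sigma_algebraType (@open PN))). Qed.

Lemma borelI A B : borel A -> borel B -> borel (A `&` B).
Proof. exact: (@measurableI _ (g_sigma_algebraType (@open PN))). Qed.

Lemma borel_inI X A B : borel_in X A -> borel_in X B -> borel_in X (A `&` B).
Proof.
move=> [A' [bA ->]] [B' [bB ->]]; exists (A' `&` B'); split; first exact: borelI.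
by rewrite setIACA setIid.
Qed.

Lemma borel_in_refl X : borel_in X X.
Proof. by exists setT; rewrite setIT; split=> //; exact: borelT. Qed.

Lemma omega_cover_seq X U (F : seq PN) : omega_cover X U -> (forall x, x \in F -> X x) ->
  exists V, U V /\ forall x, x \in F -> V x.
Proof.
move=> [_ oU] FX; have [V [UV FV]] := oU [set` F] (finite_seq F) FX.
by exists V; split=> // x /FV.
Qed.

Lemma B_Omega_intro X U : countable U ->
  (forall V, U V -> borel_in X V /\ ~ X `<=` V) ->
  (forall F : seq PN, (forall x, x \in F -> X x) ->
     exists V, U V /\ forall x, x \in F -> V x) ->
  B_Omega X U.
Proof.
move=> cU bU oU; split=> //; split; first by move=> V /bU[].
split; first split.
- apply/seteqP; split=> [x [V /bU[/borel_in_sub VX _]]|x Xx]; first exact: VX.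
  have [|V [UV xV]] := oU [:: x]; first by move=> y; rewrite inE => /eqP->.
  by exists V => //; apply: xV; rewrite inE.
- by move=> V /bU[].
- by move=> _ /finite_seqP[F ->] FX; have [V [UV FV]] := oU F FX; exists V; split.
Qed.

(** To avoid finitely many members [g i], enlarge [F] by a point of [X] missed by each of them; so
    every finite set lies in infinitely many members. *)
Lemma B_Omega_enum X U : B_Omega X U -> exists e : nat -> set PN,
  [/\ injective e, U = range e & forall F : seq PN, (forall x, x \in F -> X x) ->
    frequently (fun n => forall x, x \in F -> e n x)].
Proof.
move=> [cU [bU oU]]; have [[UX nU] _] := oU.
have avoid (g : nat -> set PN) p (F : seq PN) : (forall x, x \in F -> X x) ->
    exists V, [/\ U V, forall x, x \in F -> V x & forall i, (i < p)%N -> V <> g i].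
  move=> FX.
  have /choice[y yP] : forall i, exists y, U (g i) -> X y /\ ~ g i y.
    move=> i; have [/nU gi|nUi] := pselect (U (g i)); last by exists (fun=> false) => /nUi.
    apply: contrapT => ny; apply: gi => x Xx; apply: contrapT => gx.
    by apply: ny; exists x.
  have [|V [UV FV]] := omega_cover_seq (F := F ++ [seq y i | i <- iota 0 p & `[< U (g i) >]]) oU.
    move=> x; rewrite mem_cat => /orP[/FX//|/mapP[i]].
    by rewrite mem_filter => /andP[/asboolP/yP[Xy _] _] ->.
  exists V; split=> [//|x xF|i ip Vg]; first by apply: FV; rewrite mem_cat xF.
  have Ug : U (g i) by rewrite -Vg.
  have [_] := yP i Ug; rewrite -Vg; apply; apply: FV; rewrite mem_cat; apply/orP; right.
  by apply: map_f; rewrite mem_filter mem_iota add0n ip !andbT; apply/asboolP.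
have iU : ~ finite_set U.
  move=> /finite_setP[p /card_eqPle[/pcard_surjP[g gU] _]].
  have [//|V [UV _ Vg]] := avoid g p [::].
  by have [i ip giV] := gU V UV; apply: (Vg i ip).
have [e [e_inj UE]] := countable_infinite_enum cU iU; exists e; split=> // F FX p.
have [V []] := avoid e p F FX; rewrite UE => -[n _ <-] Fn np; exists n => //.
by rewrite leqNgt; apply/negP => /np.
Qed.

(** Apply [S_one] to the covers by intersections of [2n+2] distinct members. All members forming a
    selected intersection contain it, so two fresh ones can be sent to different halves, and each
    half contains an omega-cover. *)
Lemma S_one_split_B_Omega X :
  S_one B_Omega B_Omega X -> Split_sel B_Omega B_Omega X.
Proof.
move=> S1 U BU; have [e [e_inj UE freq_e]] := B_Omega_enum BU.
have [cU [bU [[_ nU] _]]] := BU.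
have Ue n : U (e n) by rewrite UE; exists n.
pose inter := foldr (fun i A => e i `&` A) X.
have inter_sub s i : i \in s -> inter s `<=` e i.
  by elim: s => //= j s IHs; rewrite in_cons => /predU1P[->|/IHs si] x [// _ /si].
have interP s x : X x -> (forall i, i \in s -> e i x) -> inter s x.
  move=> Xx; elim: s => //= j s IHs sx; split; first by apply: sx; rewrite mem_head.
  by apply: IHs => i si; apply: sx; rewrite in_cons si orbT.
have borel_inter s : borel_in X (inter s).
  by elim: s => [|j s IHs]; [exact: borel_in_refl|apply: borel_inI => //; exact/bU].
pose Us n : set (set PN) := inter @` [set s | uniq s /\ size s = n.*2.+2].
have BUs n : B_Omega X (Us n).
  apply: B_Omega_intro.
  - exact: sub_countable (card_image_le _ _) (countableP _).
  - move=> _ [[|i s] [_ // _] <-]; split=> // Xs; apply: (nU _ (Ue i)).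
    by apply: subset_trans Xs _; apply: inter_sub; rewrite mem_head.
  - move=> F FX; suff [s [us ss Fs]] : exists s, [/\ uniq s, size s = n.*2.+2 &
        forall i, i \in s -> forall x, x \in F -> e i x].
      exists (inter s); split; first by exists s.
      by move=> x xF; apply: interP => [|i /Fs]; [exact: FX|apply].
    elim: n.*2.+2 => [|k [s [us ss Fs]]]; first by exists [::].
    have [m sm Fm] := freq_e F FX (\max_(i <- s) i).+1.
    exists (m :: s); split=> /=; last 2 first.
    + by rewrite ss.
    + by move=> i; rewrite in_cons => /predU1P[->|/Fs].
    rewrite us andbT; apply/negP => ms; move: sm; rewrite ltnNge.
    by rewrite (@leq_bigmax_seq _ s xpredT id m ms).
have [f [fU Bf]] := S1 Us BUs.
have /choice[s sP] : forall n, exists s, [/\ uniq s, size s = n.*2.+2 & inter s = f n].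
  by move=> n; have [s [us ss] <-] := fU n; exists s.
(* From the [n]-th selected intersection, of [2n+2] members, two indices not used before. *)
have /choice[g gP] : forall np : nat * seq nat, exists ab : nat * nat,
    (size np.2 <= np.1.*2)%N -> [/\ ab.1 \in s np.1, ab.2 \in s np.1, ab.1 \notin np.2,
      ab.2 \notin np.2 & ab.1 != ab.2].
  move=> [n prev] /=.
  have [sp|sp] := leqP (size prev) n.*2; last by exists (0, 0).
  have [us ss _] := sP n.
  pose s' := [seq i <- s n | i \notin prev].
  have us' : uniq s' by exact: filter_uniq.
  have s'P i : i \in s' -> i \in s n /\ i \notin prev by rewrite mem_filter => /andP[].
  have ss' : (2 <= size s')%N.
    have sE : (size [seq i <- s n | i \in prev] + size s' = n.*2.+2)%N.
      by rewrite !size_filter -ss; exact: count_predC.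
    have : (size [seq i <- s n | i \in prev] <= n.*2)%N.
      apply: leq_trans sp; apply: uniq_leq_size; first exact: filter_uniq.
      by move=> i; rewrite mem_filter => /andP[].
    move=> le_n; rewrite -(leq_add2l n.*2) addn2 -sE leq_add2r.
    exact: le_n.
  exists (nth 0 s' 0, nth 0 s' 1) => _.
  have [a1 a2] := s'P _ (mem_nth 0 (ltnW ss')); have [b1 b2] := s'P _ (mem_nth 0 ss').
  by split=> //=; rewrite nth_uniq// ltnW.
(* The [2n] indices used in the first [n] rounds; [2n+2] members therefore leave two fresh ones. *)
pose prev := fix prev n := if n is m.+1
  then (g (m, prev m)).1 :: (g (m, prev m)).2 :: prev m else [::].
pose a n := (g (n, prev n)).1; pose b n := (g (n, prev n)).2.
have sprev n : size (prev n) = n.*2 by elim: n => //= n ->.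
have abP n : [/\ a n \in s n, b n \in s n, a n \notin prev n, b n \notin prev n & a n != b n].
  by apply: (gP (n, prev n)); rewrite /= sprev.
have prev_mem m n : (m < n)%N -> a m \in prev n /\ b m \in prev n.
  elim: n => // n IHn; rewrite ltnS leq_eqVlt => /predU1P[->|/IHn[am bm]].
    by rewrite /= !in_cons !eqxx !orbT.
  by rewrite /= !in_cons am bm !orbT.
have ab m n : a m <> b n.
  move=> mn; have [_ _ /negP am _ _] := abP m; have [_ _ _ /negP bn /eqP nn] := abP n.
  have [lt_mn|lt_nm|eq_mn] := ltngtP m n; last by apply: nn; rewrite -mn eq_mn.
    by apply: bn; rewrite -mn; have [] := prev_mem _ _ lt_mn.
  by apply: am; rewrite mn; have [] := prev_mem _ _ lt_nm.
have sub_omega (h : nat -> nat) : (forall n, h n \in s n) -> B_Omega X (e @` range h).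
  move=> hs; apply: B_Omega_intro.
  - by apply: sub_countable (card_image_le _ _) _; exact: countableP.
  - by move=> _ [n _ <-]; split; [exact/bU|exact/nU].
  - move=> F FX; have [_ [_ of_]] := Bf; have [V [[n _ <-] FV]] := omega_cover_seq of_ FX.
    exists (e (h n)); split; first by exists (h n) => //; exists n.
    by move=> x /FV; have [_ _ <-] := sP n; exact: inter_sub.
exists (e @` range a), (e @` ~` range a); split.
- by rewrite -image_setU setUv UE.
- apply/seteqP; split=> // _ [[n an <-] [m nam /e_inj mn]].
  by apply: nam; rewrite mn.
- by exists (e @` range a); split=> //; apply: sub_omega => n; have [] := abP n.
- exists (e @` range b); split; last by apply: sub_omega => n; have [] := abP n.
  by apply: image_subset => _ [n _ <-] [m _ /ab].
Qed.

(** * The two Luzin sets *)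

Lemma borel_closed (A : set PN) : closed A -> borel A.
Proof.
move=> cA; rewrite -[A]setCK -[X in borel X]setTD.
have [_ bC _] := @smallest_sigma_algebra _ setT (@open PN).
by apply: bC; apply: sub_sigma_algebra; rewrite /= openC.
Qed.

(** Closures of nowhere dense sets are nowhere dense and Borel, so a task can carry a meager set as
    a sequence of codes. *)
Lemma meager_decode M : meager M -> exists N : nat -> code,
  (forall n, nowhere_dense (decode (N n))) /\ M `<=` \bigcup_n decode (N n).
Proof.
move=> [F [nF MF]].
have /choice[N NF] : forall n, exists c, decode c = closure (F n).
  by move=> n; apply: borel_decode; apply: borel_closed; exact: closed_closure.
exists N; split=> [n|x /MF[n _ Fx]]; last by exists n => //; rewrite NF; exact: subset_closure.
rewrite /nowhere_dense NF.
by have /closure_id <- := @closed_closure PN (F n); exact: nF.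
Qed.

Lemma meager_set1 x : meager [set x].
Proof.
apply/nowhere_dense_meager/nowhere_denseP => y n.
exists (fun i => if (i < n)%N then y i else ~~ x i), n.+1; split=> // [i ->//|z yz zx].
by have := yz n (ltnSn n); rewrite ltnn zx; case: (x n).
Qed.

Lemma sub_everywhere_nonmeager X Y :
  X `<=` Y -> everywhere_nonmeager X -> everywhere_nonmeager Y.
Proof. by move=> XY nX M x n mM; have [y [/XY]] := nX M x n mM; exists y. Qed.

Lemma everywhere_nonmeager_continuum X :
  addM_eq_c -> everywhere_nonmeager X -> ([set: PN] #<= X)%card.
Proof.
move=> add nX; apply: contrapT => /(small_addM add) sX.
have [y [Xy _]] := nX _ (fun=> false) 0 (sX _ (fun x _ => meager_set1 x)).
by apply; exists y.
Qed.

Lemma clopen_in_coord X n : clopen_in X (X `&` [set x | x n]).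
Proof.
have oC b : open [set x : PN | x n = b].
  by rewrite openE => x xn; apply: filterS (nbhs_cyl x n.+1) => y /(_ n (ltnSn n)) /= ->.
exists [set x : PN | x n = true], [set x : PN | x n = false]; split=> //.
apply/seteqP; split=> x [Xx xn]; split=> //=; last by move=> [_]; rewrite /= xn.
by apply/negP => xn'; apply: xn.
Qed.

(** If a cover member contains [Z] and agrees off [M] with an open set, that open set hits all
    cylinders of length [m]; [Z] takes a point from each of them. *)
Lemma hits_finite (L : set PN) M m : everywhere_nonmeager L -> meager M ->
  exists Z : seq PN, (forall x, x \in Z -> L x /\ ~ M x) /\
    forall x, exists2 z, z \in Z & cyl x m z.
Proof.
move=> nL mM.
have /choice[z zP] : forall t : {ffun 'I_m -> bool}, exists z, [/\ L z,
    forall i : 'I_m, z i = t i & ~ M z].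
  move=> t; have [z [Lz zt nMz]] := nL M (fun i => if insub i is Some j then t j else false) m mM.
  by exists z; split=> // i; rewrite zt//= valK.
exists (codom z); split=> [x /codomP[t ->]|x]; first by have [] := zP t.
exists (z [ffun i : 'I_m => x i]); first exact: codom_f.
by move=> i im; have [_ /(_ (Ordinal im)) /= -> _] := zP [ffun i : 'I_m => x i]; rewrite ffunE.
Qed.

(* Side, length and center of the cylinder that the new point on this side must enter; set to
   be decided by the ultrafilter; codes of nowhere dense sets to be avoided; codes of a sequence
   of countable Borel families. *)
Definition task : Type := bool * nat * PN * PN * (nat -> code) * (nat -> nat -> code).

Lemma embeds_task : embeds task.
Proof.
have ePN : embeds PN by apply: embeds_fun; exact: embeds_count.
do !apply: embeds_prod => //; try exact: embeds_count.
  by apply: embeds_fun; exact: embeds_code.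
by do 2!apply: embeds_fun; exact: embeds_code.
Qed.

Lemma luzin_pair : addM_eq_c -> exists L : bool -> set PN, [/\
  forall i, everywhere_nonmeager (L i),
  forall i M, meager M -> ~ ([set: PN] #<= (L i `&` M))%card,
  centered (L false `|` L true),
  forall y : PN, exists a b z : PN, [/\ L false a, L true b,
    z = y \/ z = (fun n => ~~ y n) & forall n, a n -> b n -> z n] &
  forall i, S_one B_Omega B_Omega (L i)].
Proof.
move=> add; have [S [lt [tau [wf_lt tot_lt tr_lt seg_lt tau_surj]]]] := continuum_well_order.
have [g g_surj] : exists g : PN -> task, forall t, exists x, g x = t.
  apply: embeds_surj embeds_task.
  exact: (inhabits (false, 0, (fun=> false), (fun=> false), (fun=> Cbase 0), (fun _ _ => Cbase 0))).
have {g_surj tau_surj} [T T_surj] : exists T : S -> task, forall t, exists a, T a = t.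
  exists (g \o tau) => t; have [x gx] := g_surj t; have [a ax] := tau_surj x.
  by exists a; rewrite /= ax.
have lt_irr a : ~ lt a a by elim/(well_founded_ind wf_lt): a => a IHa aa; exact: (IHa a aa aa).
have /choice[hull /choice[exc hullP]] := baire_property.
pose side a := (T a).1.1.1.1.1; pose sn a := (T a).1.1.1.1.2; pose sx a := (T a).1.1.1.2.
pose y a := (T a).1.1.2; pose N a := (T a).1.2; pose C a := (T a).2.
(* Coded sets that are not nowhere dense are replaced by the empty set. The sets [exc] are included
   so that off [M a] the coded Borel sets agree with their open hulls. *)
pose M a := \bigcup_n
    (if pselect (nowhere_dense (decode (N a n))) is left _ then decode (N a n) else set0)
  `|` \bigcup_n \bigcup_k exc (C a n k).
have meagerM a : meager (M a).
  apply: meagerU; apply: meager_bigcupT => n.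
    by case: pselect => [nN|_]; [exact: nowhere_dense_meager|exact: meager0].
  by apply: meager_bigcupT => k; have [] := hullP (C a n k).
have hullE a n k x : ~ M a x -> (decode (C a n k) x <-> hull (C a n k) x).
  move=> nM; have [_ _] := hullP (C a n k); apply=> ex; apply: nM; right.
  by exists n => //; exists k.
have [pt [sel [ptM cen ptz ptc ptsel]]] := @construction S lt wf_lt tot_lt tr_lt
  (fun a => small_addM add (@seg_lt a)) side sx sn y M
  (fun a n k => decode (C a n k)) (fun a n k => hull (C a n k)) meagerM
  (fun a n k => let: And3 H _ _ := hullP (C a n k) in H)
  (fun a n k x nM => proj2 (hullE a n k x nM)).
pose L i := [set x | exists a, x = pt a i].
have LM i a M0 n0 x0 y0 N0 C0 : T a = (i, n0, x0, y0, N0, C0) ->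
    (forall n, nowhere_dense (decode (N0 n))) -> M0 `<=` \bigcup_n decode (N0 n) ->
    M0 `<=` M a.
  move=> Ta nN MN x /MN[n _ Nx]; left; exists n => //.
  by rewrite /N Ta /=; case: pselect.
have nmL i : everywhere_nonmeager (L i).
  move=> M0 x n /meager_decode[N0 [nN0 MN0]].
  have [a Ta] := T_surj (i, n, x, (fun=> false), N0, fun _ _ => Cbase 0).
  exists (pt a i); split; first by exists a.
    by have := ptc a; rewrite /sx /sn /side Ta.
  by move=> /(LM _ _ _ _ _ _ _ _ Ta nN0 MN0); exact: ptM.
exists L; split=> //.
- move=> i M0 /meager_decode[N0 [nN0 MN0]].
  have [a Ta] := T_surj (i, 0, (fun=> false), (fun=> false), N0, fun _ _ => Cbase 0).
  (* Points of stage [a] and later avoid [M a], which covers [M0]; the earlier ones are too few. *)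
  have sub : L i `&` M0 `<=` (fun b => pt b i) @` [set b | lt b a].
    move=> _ [[b ->] Mb]; exists b => //=; apply: contrapT => nba.
    by apply: (ptM b a i nba); apply: (LM _ _ _ _ _ _ _ _ Ta nN0 MN0).
  move=> cLM; apply: (seg_lt a); apply: card_le_trans cLM _.
  exact: card_le_trans (subset_card_le sub) (card_image_le _ _).
- by move=> F FL; apply: cen => x /FL[[a ->]|[a ->]]; exists a; [exists false|exists true].
- move=> y0.
  have [a Ta] := T_surj (false, 0, (fun=> false), y0, (fun=> Cbase 0), fun _ _ => Cbase 0).
  have [z [zy abz]] := ptz a.
  exists (pt a false), (pt a true), z; split=> //; [by exists a|by exists a|].
  by move: zy; rewrite /y Ta.
move=> i Us BUs.
have /choice[e eP] : forall n, exists e : nat -> set PN, Us n = range e /\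
    forall F : seq PN, (forall x, x \in F -> L i x) -> exists k, forall x, x \in F -> e k x.
  move=> n; have [e [_ UE eF]] := B_Omega_enum (BUs n); exists e; split=> // F FL.
  by have [k _ Fk] := eF F FL 0; exists k.
have Ue n k : Us n (e n k) by have [-> _] := eP n; exists k.
have /choice[C1 C1P] : forall nk : nat * nat, exists c,
    e nk.1 nk.2 = L i `&` decode c.
  move=> [n k]; have [_ [/(_ _ (Ue n k))[B [/borel_decode[c <-] eB]] _]] := BUs n.
  by exists c.
pose C0 n k := C1 (n, k); have C0P n k : e n k = L i `&` decode (C0 n k) := C1P (n, k).
have [a Ta] := T_surj (i, 0, (fun=> false), (fun=> false), (fun=> Cbase 0), C0).
have CE : C a = C0 by rewrite /C Ta.
(* The families cover the finished set [L i], so [Z] may use points of any stage; richness over the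
   points before [a] follows, and [ptsel] returns a selection for all of [L i]. *)
have : rich [set x | exists2 b, lt b a & x = pt b i]
    (fun n k => decode (C a n k)) (fun n k => hull (C a n k)).
  move=> F Fa n m; have [Z [ZL Zm]] := hits_finite m (nmL i) (meagerM a).
  have [_ /(_ (F ++ Z))[|k Fk]] := eP n.
    by move=> x; rewrite mem_cat => /orP[/Fa[b _ ->]|/ZL[]//]; exists b.
  exists k; split=> [x xF|x].
    have := Fk x; rewrite mem_cat xF C0P => /(_ isT)[_].
    by rewrite CE.
  have [z zZ xz] := Zm x; exists z => //; have [_ nMz] := ZL z zZ; apply/hullE => //.
  have := Fk z; rewrite mem_cat zZ orbT C0P => /(_ isT)[_].
  by rewrite CE.
move=> /ptsel selL; exists (fun n => e n (sel a i n)); split=> //.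
apply: B_Omega_intro; first by apply: sub_countable (card_image_le _ _) _; exact: countableP.
  by move=> _ [n _ <-]; have [_ [bU [[_ nU] _]]] := BUs n; split; [exact/bU|exact/nU].
move=> F FL; have [n [Fn _]] := selL F FL 0.
exists (e n (sel a i n)); split; first by exists n.
by move=> x xF; rewrite C0P; split; [exact: FL|rewrite -CE; exact: Fn].
Qed.

(* A splitting of the omega-cover by the sets [{x | n \in x}] would give a set of indices that
   neither contains nor misses a finite intersection of members of [X]. *)
Lemma ultrafilter_base_not_split X : centered X ->
  (forall y : PN, exists a b z : PN, [/\ X a, X b,
    z = y \/ z = (fun n => ~~ y n) & forall n, a n -> b n -> z n]) ->
  ~ Split_sel C_Omega C_Omega X.
Proof.
move=> cX ultra; pose V n : set PN := X `&` [set x | x n].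
have X2 a b : X a -> X b -> forall x, x \in [:: a; b] -> X x.
  by move=> Xa Xb x; rewrite !inE => /orP[/eqP->|/eqP->].
have VF (F : seq PN) : (forall x, x \in F -> X x) -> exists n, forall x, x \in F -> V n x.
  by move=> FX; have [n _ Fn] := cX F FX 0; exists n => x xF; split; [exact: FX|exact: Fn].
have CV : C_Omega X (range V).
  split; first by apply: sub_countable (card_image_le _ _) _; exact: countableP.
  split; first by move=> _ [n _ <-]; exact: clopen_in_coord.
  split; first split.
  - apply/seteqP; split=> [x [_ [n _ <-] []//]|x Xx].
    have [|n Fn] := VF [:: x]; first by move=> w; rewrite inE => /eqP->.
    by exists (V n); [exists n|apply: Fn; rewrite inE].
  (* Decide the complement of the singleton of [n]: if [a] and [b] both contained [n], their
     intersection would not be inside it, and, being infinite, not inside the singleton either. *)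
  - move=> _ [n _ <-] XV; have [a [b [z [Xa Xb zy abz]]]] := ultra (fun k => k != n).
    have [k nk Fk] := cX _ (X2 a b Xa Xb) n.+1.
    case: zy => zE.
      have [_ an] := XV a Xa; have [_ bn] := XV b Xb.
      by have := abz n an bn; rewrite zE eqxx.
    have := abz k (Fk a (mem_head _ _)) (Fk b _); rewrite !inE eqxx orbT => /(_ isT).
    by rewrite zE negbK => /eqP kn; rewrite kn ltnn in nk.
  - move=> _ /finite_seqP[F ->] FX; have [n Fn] := VF F FX.
    by exists (V n); split; [exists n|].
move=> /(_ _ CV)[U1 [U2 [UU U12 [V1 [VU1 [_ [_ o1]]]] [V2 [VU2 [_ [_ o2]]]]]]].
have [a [b [z [Xa Xb zy abz]]]] := ultra (fun n => `[< U1 (V n) >]).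
have Vz W n : W = V n -> (forall x, x \in [:: a; b] -> W x) -> z n.
  move=> -> WF; apply: abz; first by have [] := WF a (mem_head _ _).
  by have [] // := WF b; rewrite !inE eqxx orbT.
have [W1 [/VU1 UW1 F1]] := omega_cover_seq o1 (X2 a b Xa Xb).
have [W2 [/VU2 UW2 F2]] := omega_cover_seq o2 (X2 a b Xa Xb).
have [n1 _ n1W] : range V W1 by rewrite -UU; left.
have [n2 _ n2W] : range V W2 by rewrite -UU; right.
have zn1 := Vz _ _ (esym n1W) F1; have zn2 := Vz _ _ (esym n2W) F2.
case: zy => zE; rewrite zE in zn1 zn2.
  have : (U1 `&` U2) W2 by split=> //; rewrite -n2W; exact/asboolP.
  by rewrite U12.
by move/negP: zn1; apply; apply/asboolP; rewrite n1W.
Qed.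

Theorem theorem6p2 : addM_eq_c ->
  exists L0 L1 : set PN,
    [/\ L0 `<=` infinite_subsets, L1 `<=` infinite_subsets,
        c_Luzin L0, c_Luzin L1 &
    [/\ S_one B_Omega B_Omega L0 /\ Split_sel B_Omega B_Omega L0 /\ Split_sel B_Lambda B_Lambda L0,
        S_one B_Omega B_Omega L1 /\ Split_sel B_Omega B_Omega L1 /\ Split_sel B_Lambda B_Lambda L1,
        Split_sel B_Lambda B_Lambda (L0 `|` L1) &
        ~ Split_sel C_Omega C_Omega (L0 `|` L1)]].
Proof.
move=> add; have [L [nmL luzL cenL ultraL S1L]] := luzin_pair add.
have infL i : L i `<=` infinite_subsets.
  move=> x Lx /finite_set_bounded[p xp].
  have [|n pn Fn] := cenL [:: x] _ p.
    by move=> w; rewrite inE => /eqP->; case: i Lx => Lx; [right|left].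
  by have := xp n (Fn x (mem_head _ _)); rewrite ltnNge pn.
have smallL i M : meager M -> small (L i `&` M).
  by move=> /(luzL i)/(small_addM add).
have luzinL i : c_Luzin (L i).
  by split; [exact: everywhere_nonmeager_continuum|exact: luzL].
have selL i : S_one B_Omega B_Omega (L i) /\ Split_sel B_Omega B_Omega (L i) /\
    Split_sel B_Lambda B_Lambda (L i).
  split=> //; split; first exact: S_one_split_B_Omega.
  by apply: split_B_Lambda => // M; exact: smallL.
exists (L false), (L true); split=> //; split=> //.
- apply: split_B_Lambda => [|M mM]; first exact: sub_everywhere_nonmeager (nmL false).
  by rewrite setIUl; apply: smallU; exact: smallL.
- apply: ultrafilter_base_not_split => // y.
  have [a [b [z [La Lb zy abz]]]] := ultraL y.
  by exists a, b, z; split=> //; [left|right].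
Qed.
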